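(* Let $J:\mathcal A\to\mathbb R$ be a shape functional, where $\mathcal A$ contains all open subsets of $\mathsf D$, and let $\ell:(0,\delta)\to(0,\infty)$, $\delta>0$, be a function with $|B_\varepsilon|^2<\ell(\varepsilon)<|B_\varepsilon|$ for all small $\varepsilon>0$ and $\ell(\varepsilon)=o(|B_\varepsilon|)$ as $\varepsilon\searrow0$. Assume that the topological derivatives $DJ(\Omega)(x_1)$ and $D^2J(\Omega)(x_1,x_2)$ ($x_1\neq x_2$) exist, that real numbers $D^{\frac32}J(\Omega)(x_1,x_1)$ and $D^2J(\Omega)(x_1,x_1)$ are given for every open $\Omega\subset\mathsf D$ and every $x_1\in\mathsf D\setminus\partial\Omega$, and that the following hold. (A1) For every open $\Omega\subset\mathsf D$ and every $x_1\in\mathsf D\setminus\partial\Omega$, $$J(\Omega_{\varepsilon_1})=J(\Omega)+|B_{\varepsilon_1}|\,DJ(\Omega)(x_1)+\ell(\varepsilon_1)D^{\frac32}J(\Omega)(x_1,x_1)+\frac{|B_{\varepsilon_1}|^2}{2}D^2J(\Omega)(x_1,x_1)+\mathcal R^{(1)}_{\Omega,x_1}(\varepsilon_1)$$ with $|\mathcal R^{(1)}_{\Omega,x_1}(\varepsilon)|=o(|B_\varepsilon|^2)$ uniformly in $\Omega$. (A2) For every open $\Omega\subset\mathsf D$ and all $x_1,x_2\in\mathsf D\setminus\partial\Omega$, $x_1\ne x_2$, $$DJ(\Omega_{\varepsilon_2})(x_1)=DJ(\Omega)(x_1)+|B_{\varepsilon_2}|D^2J(\Omega)(x_1,x_2)+\mathcal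 R^{(2)}_{\Omega,x_1,x_2}(\varepsilon_2)$$ with $|\mathcal R^{(2)}_{\Omega,x_1,x_2}(\varepsilon)|=o(|B_\varepsilon|)$ uniformly in $\Omega$. (A3) For every open $\Omega\subset\mathsf D$ and all $x_1,x_2\in\mathsf D\setminus\partial\Omega$, $x_1\ne x_2$, $$D^{\frac32}J(\Omega_{\varepsilon_2})(x_1,x_1)=D^{\frac32}J(\Omega)(x_1,x_1)+\mathcal R^{(3)}_{\Omega,x_1,x_2}(\varepsilon_2)$$ with $|\mathcal R^{(3)}_{\Omega,x_1,x_2}(\varepsilon)|=O(|B_\varepsilon|)$ uniformly in $\Omega$. (A4) For every open $\Omega\subset\mathsf D$ and all $x_1,x_2,x_3\in\mathsf D\setminus\partial\Omega$ with $x_1\ne x_3$ and $x_2\neq x_3$ (the case $x_1=x_2$ is allowed), $$D^2J(\Omega_{\varepsilon_3})(x_1,x_2)=D^2J(\Omega)(x_1,x_2)+\mathcal R^{(4)}_{\Omega,x_1,x_2}(\varepsilon_3)$$ with $|\mathcal R^{(4)}_{\Omega,x_1,x_2}(\varepsilon)|=o(1)$ uniformly in $\Omega$ (the remainder may also depend on $x_3$). Here $\Omega_{\varepsilon_i}:=\Omega_{\varepsilon_i}(x_i)$. Then for every open $\Omega\subset\mathsf D$, every $n\ge1$ and all $x_1,\dots,x_n\in\mathsf D\setminus\partial\Omega$ with $x_i\neq x_j$ for $i\ne j$, as $\varepsilon_1,\dots,\varepsilon_n\searrow0$, $$\begin{aligned}J(\Omega_{\varepsilon_1,\dots,\varepsilon_n})=J(\Omega)&+D\mathbf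 J(\Omega)(x_1,\dots,x_n)\cdot\begin{pmatrix}|B_{\varepsilon_1}|\\\vdots\\|B_{\varepsilon_n}|\end{pmatrix}+D^{\frac32}\mathbf J(\Omega)(x_1,\dots,x_n)\begin{pmatrix}\sqrt{\ell(\varepsilon_1)}\\\vdots\\\sqrt{\ell(\varepsilon_n)}\end{pmatrix}\cdot\begin{pmatrix}\sqrt{\ell(\varepsilon_1)}\\\vdots\\\sqrt{\ell(\varepsilon_n)}\end{pmatrix}\\&+\frac12D^2\mathbf J(\Omega)(x_1,\dots,x_n)\begin{pmatrix}|B_{\varepsilon_1}|\\\vdots\\|B_{\varepsilon_n}|\end{pmatrix}\cdot\begin{pmatrix}|B_{\varepsilon_1}|\\\vdots\\|B_{\varepsilon_n}|\end{pmatrix}+o(|B_{\varepsilon_1}|^2+\cdots+|B_{\varepsilon_n}|^2),\end{aligned}$$ where $D\mathbf J(\Omega)(x_1,\dots,x_n)=(DJ(\Omega)(x_i))_{i=1}^n\in\mathbb R^n$; $D^{\frac32}\mathbf J(\Omega)(x_1,\dots,x_n)$ is the diagonal $n\times n$ matrix with diagonal entries $D^{\frac32}J(\Omega)(x_i,x_i)$; and $D^2\mathbf J(\Omega)(x_1,\dots,x_n)$ is the symmetric $n\times n$ matrix whose $(i,j)$ entry for $i\le j$ is $D^2J(\Omega)(x_i,x_j)$.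
   Context: $d\in\{2,3\}$ and $\mathsf D\subset\mathbb R^d$ is a bounded domain with $C^1$ boundary. $B_\varepsilon(x)$ is the open Euclidean ball of radius $\varepsilon$ centred at $x$, $B_\varepsilon:=B_\varepsilon(0)$, and $|\cdot|$ applied to sets is Lebesgue measure (so $|B_\varepsilon(x)|=|B_\varepsilon|$). For $\Omega\subset\mathsf D$ open and $x_1\in\mathsf D\setminus\partial\Omega$ set $\Omega_\varepsilon(x_1):=\Omega\setminus\overline{B_\varepsilon(x_1)}$ if $x_1\in\Omega$ and $\Omega_\varepsilon(x_1):=\Omega\cup B_\varepsilon(x_1)$ if $x_1\in\mathsf D\setminus\overline\Omega$. For pairwise distinct $x_1,\dots,x_n\in\mathsf D\setminus\partial\Omega$ and small radii, $\Omega_{\varepsilon_1,\dots,\varepsilon_n}=\Omega_{\varepsilon_1,\dots,\varepsilon_n}(x_1,\dots,x_n)$ is obtained by performing these perturbations successively at $x_1,\dots,x_n$ (remove $\overline{B_{\varepsilon_i}(x_i)}$ if $x_i\in\Omega$, add $B_{\varepsilon_i}(x_i)$ if $x_i\in\mathsf D\setminus\overline\Omega$). Topological derivatives: $DJ(\Omega)(x_1):=\lim_{\varepsilon\searrow0}\frac{J(\Omega_\varepsilon(x_1))-J(\Omega)}{|B_\varepsilon|}$ and, for $x_1\neq x_2$, $D^2J(\Omega)(x_1,x_2):=\lim_{\varepsilon\searrow0}\frac{DJ(\Omega_\varepsilon(x_2))(x_1)-DJ(\Omega)(x_1)}{|B_\varepsilon|}$. The diagonal quantities $D^{\frac32}J(\Omega)(x_1,x_1)$,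 $D^2J(\Omega)(x_1,x_1)$ are the coefficients of $\ell(\varepsilon_1)$ and $|B_{\varepsilon_1}|^2/2$ in the one-hole expansion (A1). Uniformity: given remainders $\mathcal R_\Omega(\varepsilon)$ (possibly depending on base points such as $x_1,x_2$) and a positive function $f(\varepsilon)$, ''$|\mathcal R_\Omega(\varepsilon)|=O(f(\varepsilon))$ uniformly in $\Omega$'' means: for every $m\ge0$ and all pairwise distinct hole centres $y_1,\dots,y_m\in\mathsf D\setminus\partial\Omega$, different from the base points, there are $\zeta>0$, $C>0$ with $|\mathcal R_{\Omega_{\varepsilon_1,\dots,\varepsilon_m}(y_1,\dots,y_m)}(\varepsilon)|\le Cf(\varepsilon)$ for all $\varepsilon,\varepsilon_1,\dots,\varepsilon_m\in(0,\zeta]$. ''$o(f(\varepsilon))$ uniformly in $\Omega$'' is defined in the same way: for every $c>0$ there is $\zeta>0$ such that the bound holds with $C=c$. *)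

(* Defs.v *)
From HB Require Import structures.
From mathcomp Require Import all_boot all_order all_algebra.
From mathcomp Require Import all_classical all_reals all_analysis.
Set Implicit Arguments.
Unset Strict Implicit.
Unset Printing Implicit Defensive.
Import Order.TTheory GRing.Theory Num.Theory.
Import numFieldNormedType.Exports.
Local Open Scope classical_set_scope.
Local Open Scope ring_scope.

(* The library's norm on 'rV[R]_d is the sup norm (it only provides the
   topology here), hence the explicit Euclidean structure. *)
Definition dotrv (R : realType) (d : nat) (u v : 'rV[R]_d) : R :=
  \sum_(i < d) u 0 i * v 0 i.

Definition enorm (R : realType) (d : nat) (u : 'rV[R]_d) : R :=
  Num.sqrt (dotrv u u).

Definition eball (R : realType) (d : nat) (x : 'rV[R]_d) (e : R) :
    set 'rV[R]_d :=
  [set y | enorm (y - x) < e].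

(* d-dimensional Lebesgue (outer) measure: infimum of the total volumes of
   countable covers by boxes. *)
Definition box (R : realType) (d : nat) (a b : 'rV[R]_d) : set 'rV[R]_d :=
  [set y | forall i, a 0 i < y 0 i <= b 0 i].

Definition lebesgue_rV (R : realType) (d : nat) (A : set 'rV[R]_d) : \bar R :=
  ereal_inf [set s | exists a b : nat -> 'rV[R]_d,
    [/\ forall k i, a k 0 i <= b k 0 i,
        A `<=` \bigcup_k box (a k) (b k) &
        s = (\sum_(0 <= k <oo) (\prod_(i < d) (b k 0 i - a k 0 i))%:E)%E]].

Definition ball_vol (R : realType) (d : nat) (e : R) : R :=
  fine (lebesgue_rV (eball (0 : 'rV[R]_d) e)).

Definition boundary (T : topologicalType) (A : set T) : set T :=
  closure A `\` interior A.

Definition C1_fun (R : realType) (d : nat) (g : 'rV[R]_d -> R) : Prop :=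
  (forall x, differentiable g x) /\
  (forall v : 'rV[R]_d, continuous (fun x => 'D_v g x)).

(* Near each boundary point, A is the region on one side of the graph of a C^1
   function over a hyperplane: nu is the unit normal of that hyperplane, and
   x - <x, nu> nu is the orthogonal projection of x onto it. *)
Definition C1_boundary (R : realType) (d : nat) (A : set 'rV[R]_d) : Prop :=
  forall p, boundary A p ->
  exists (nu : 'rV[R]_d) (g : 'rV[R]_d -> R) (r : R),
    [/\ enorm nu = 1, C1_fun g, 0 < r &
        forall x, eball p r x ->
          (A x <-> g (x - dotrv x nu *: nu) < dotrv x nu)].

Definition bounded_C1_domain (R : realType) (d : nat) (D : set 'rV[R]_d) :
    Prop :=
  [/\ open D, connected D, D !=set0, bounded_set D & C1_boundary D].

(* A shape functional defined on the class A only, extended by 0 so that it can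
   be applied to perturbed sets without carrying membership proofs. *)
Definition extend0 (R : realType) (d : nat) (A : set (set 'rV[R]_d))
    (J : A -> R) (S : set 'rV[R]_d) : R :=
  oapp J 0 (insub S).

(* The base points D \ boundary W at which W may be perturbed. *)
Definition admissible (R : realType) (d : nat) (D W : set 'rV[R]_d) :
    set 'rV[R]_d :=
  D `\` boundary W.

(* Only used for x outside the boundary of W, so that the second case is the
   case of x outside the closure of W. *)
Definition perturb (R : realType) (d : nat) (W : set 'rV[R]_d)
    (x : 'rV[R]_d) (e : R) : set 'rV[R]_d :=
  if x \in W then W `\` closure (eball x e) else W `|` eball x e.

Definition perturbs (R : realType) (d : nat) (W : set 'rV[R]_d) (n : nat)
    (x : 'I_n -> 'rV[R]_d) (e : 'I_n -> R) : set 'rV[R]_d :=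
  foldl (fun S i => perturb S (x i) (e i)) W (enum 'I_n).

Definition topD_quot (R : realType) (d : nat) (J : set 'rV[R]_d -> R)
    (W : set 'rV[R]_d) (x : 'rV[R]_d) (e : R) : R :=
  (J (perturb W x e) - J W) / ball_vol d e.

Definition topD (R : realType) (d : nat) (J : set 'rV[R]_d -> R)
    (W : set 'rV[R]_d) (x : 'rV[R]_d) : R :=
  lim (topD_quot J W x e @[e --> 0^'+]).

Definition topD2_quot (R : realType) (d : nat) (J : set 'rV[R]_d -> R)
    (W : set 'rV[R]_d) (x1 x2 : 'rV[R]_d) (e : R) : R :=
  (topD J (perturb W x2 e) x1 - topD J W x1) / ball_vol d e.

(* Off the diagonal this is the iterated topological derivative; on the
   diagonal it is the prescribed coefficient D2d. *)
Definition topD2 (R : realType) (d : nat) (J : set 'rV[R]_d -> R)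
    (D2d : set 'rV[R]_d -> 'rV[R]_d -> R)
    (W : set 'rV[R]_d) (x1 x2 : 'rV[R]_d) : R :=
  if x1 == x2 then D2d W x1 else lim (topD2_quot J W x1 x2 e @[e --> 0^'+]).

Definition hole_centres (R : realType) (d : nat) (D W : set 'rV[R]_d)
    (base : seq 'rV[R]_d) (m : nat) (y : 'I_m -> 'rV[R]_d) : Prop :=
  injective y /\ (forall i, admissible D W (y i) /\ y i \notin base).

(* rem S e is the remainder attached to the set S; m = 0 is allowed. *)
Definition uniformly_O (R : realType) (d : nat) (D W : set 'rV[R]_d)
    (base : seq 'rV[R]_d) (rem : set 'rV[R]_d -> R -> R) (f : R -> R) : Prop :=
  forall (m : nat) (y : 'I_m -> 'rV[R]_d), hole_centres D W base y ->
  exists zeta C : R, [/\ 0 < zeta, 0 < C &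
    forall (e : R) (es : 'I_m -> R),
      0 < e <= zeta -> (forall i, 0 < es i <= zeta) ->
      `|rem (perturbs W y es) e| <= C * f e].

Definition uniformly_o (R : realType) (d : nat) (D W : set 'rV[R]_d)
    (base : seq 'rV[R]_d) (rem : set 'rV[R]_d -> R -> R) (f : R -> R) : Prop :=
  forall (m : nat) (y : 'I_m -> 'rV[R]_d), hole_centres D W base y ->
  forall c : R, 0 < c -> exists2 zeta : R, 0 < zeta &
    forall (e : R) (es : 'I_m -> R),
      0 < e <= zeta -> (forall i, 0 < es i <= zeta) ->
      `|rem (perturbs W y es) e| <= c * f e.

Definition remainder1 (R : realType) (d : nat) (J : set 'rV[R]_d -> R)
    (ell : R -> R) (D32 D2d : set 'rV[R]_d -> 'rV[R]_d -> R)
    (x1 : 'rV[R]_d) (W : set 'rV[R]_d) (e : R) : R :=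
  J (perturb W x1 e) -
  (J W + ball_vol d e * topD J W x1 + ell e * D32 W x1
   + ball_vol d e ^+ 2 / 2 * topD2 J D2d W x1 x1).

Definition remainder2 (R : realType) (d : nat) (J : set 'rV[R]_d -> R)
    (D2d : set 'rV[R]_d -> 'rV[R]_d -> R)
    (x1 x2 : 'rV[R]_d) (W : set 'rV[R]_d) (e : R) : R :=
  topD J (perturb W x2 e) x1 -
  (topD J W x1 + ball_vol d e * topD2 J D2d W x1 x2).

Definition remainder3 (R : realType) (d : nat)
    (D32 : set 'rV[R]_d -> 'rV[R]_d -> R)
    (x1 x2 : 'rV[R]_d) (W : set 'rV[R]_d) (e : R) : R :=
  D32 (perturb W x2 e) x1 - D32 W x1.

Definition remainder4 (R : realType) (d : nat) (J : set 'rV[R]_d -> R)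
    (D2d : set 'rV[R]_d -> 'rV[R]_d -> R)
    (x1 x2 x3 : 'rV[R]_d) (W : set 'rV[R]_d) (e : R) : R :=
  topD2 J D2d (perturb W x3 e) x1 x2 - topD2 J D2d W x1 x2.

Definition topDvec (R : realType) (d : nat) (J : set 'rV[R]_d -> R)
    (W : set 'rV[R]_d) (n : nat) (x : 'I_n -> 'rV[R]_d) : 'cV[R]_n :=
  \col_i topD J W (x i).

Definition topD32mx (R : realType) (d : nat)
    (D32 : set 'rV[R]_d -> 'rV[R]_d -> R)
    (W : set 'rV[R]_d) (n : nat) (x : 'I_n -> 'rV[R]_d) : 'M[R]_n :=
  diag_mx (\row_i D32 W (x i)).

Definition topD2mx (R : realType) (d : nat) (J : set 'rV[R]_d -> R)
    (D2d : set 'rV[R]_d -> 'rV[R]_d -> R)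
    (W : set 'rV[R]_d) (n : nat) (x : 'I_n -> 'rV[R]_d) : 'M[R]_n :=
  \matrix_(i, j) if (i <= j)%N then topD2 J D2d W (x i) (x j)
                 else topD2 J D2d W (x j) (x i).

Definition dotcv (R : realType) (n : nat) (u v : 'cV[R]_n) : R :=
  (u^T *m v) 0 0.

(* Main.v *)
Require Import Defs.
From HB Require Import structures.
From mathcomp Require Import all_boot all_order all_algebra.
From mathcomp Require Import all_classical all_reals all_analysis.
From mathcomp Require Import ring lra.
Import Order.TTheory GRing.Theory Num.Theory.
Import numFieldNormedType.Exports.
Local Open Scope classical_set_scope.
Local Open Scope ring_scope.
Set Implicit Arguments.
Unset Strict Implicit.
Unset Printing Implicit Defensive.

(** The expansion is obtained by making the holes one after another. Making one
    more hole, at x_i, in a set P that already has holes at the x_j with j in s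
    changes J by
      b_i DJ(P)(x_i) + l(e_i) D^{3/2}J(P)(x_i,x_i) + b_i^2/2 D^2J(P)(x_i,x_i),
    up to o(b_i^2), where b_i = |B_{e_i}|. This is the one-hole expansion at P;
    its remainder is controlled because uniformity of the remainders is
    precisely uniformity with respect to holes made beforehand. The three
    coefficients are then moved from P back to W, filling the holes of s one at
    a time ([topD_pierce], [D32_pierce], [topD2_pierce]):
      DJ(P)(x_i) = DJ(W)(x_i) + sum_j b_j D^2J(W)(x_i,x_j) + o(sum_j b_j),
      D^{3/2}J(P)(x_i,x_i) = D^{3/2}J(W)(x_i,x_i) + O(sum_j b_j),
      D^2J(P)(x_i,x_i) = D^2J(W)(x_i,x_i) + o(1).
    The first line yields the mixed second order terms b_i b_j D^2J(W)(x_i,x_j).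
    The error of the second one is multiplied by l(e_i) = o(b_i), and the
    products b_i b_j that occur are bounded by b_i^2 + b_j^2, so everything else
    is o(sum_i b_i^2). Summing over the holes gives [J_pierce].

    This produces D^2J(W)(x_i,x_j) with the hole at x_j made before that at x_i,
    whereas the matrix of the theorem has this entry for i < j. The holes must
    therefore be made in the order x_n, ..., x_1, opposite to that of the
    perturbed set of the theorem. The two orders give the same set: for small
    radii the closed balls around the x_i are pairwise disjoint, and then the
    perturbations commute ([perturbC], [perturbs_pierce]). *)

(** * The filter of small radii *)

(** Radii below a common bound: the filter that turns statements of the form
    there is zeta such that for all radii in (0, zeta] into near statements. *)
Definition small_radii (R : realType) (I : Type) : set_system (I -> R) :=
  [set P | exists2 zeta : R, 0 < zeta &
     forall e : I -> R, (forall i, 0 < e i <= zeta) -> P e].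

#[global] Instance small_radii_filter (R : realType) (I : Type) :
  Filter (@small_radii R I).
Proof.
split=> [|P Q [z z0 Pz] [t t0 Qt]|P Q PQ [z z0 Pz]]; first by exists 1.
- exists (Num.min z t) => [|e he]; first by rewrite lt_min z0.
  split; [apply: Pz|apply: Qt] => i; have /andP[-> ] := he i;
    by rewrite le_min => /andP[].
- by exists z => // e /Pz /PQ.
Qed.

Lemma near_small_radii (R : realType) (I : Type) (P : R -> Prop) :
  (\forall r \near 0^'+, P r) ->
  \forall e \near @small_radii R I, forall i, P (e i).
Proof.
move=> [z /= z0 Pz]; exists (z / 2) => [|e he i]; first by rewrite divr_gt0.
have /andP[ei0 eiz] := he i; apply: Pz => //=.
rewrite sub0r normrN gtr0_norm //; lra.
Qed.

(** * Perturbations with disjoint closed balls *)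

(** Bounds the Euclidean norm below by the norm that defines the topology, so
    that closures of Euclidean balls can be controlled. *)
Lemma sup_norm_le_enorm (R : realType) (d : nat) (u : 'rV[R]_d) :
  `|u| <= enorm u.
Proof.
rewrite [`|u|]mx_normrE; apply/bigmax_leP; split=> [|[i j] _ /=].
  exact: sqrtr_ge0.
rewrite ord1 -sqrtr_sqr; apply: ler_wsqrtr.
rewrite /dotrv (bigD1 j) //= expr2 lerDl sumr_ge0 // => k _.
by rewrite -expr2 sqr_ge0.
Qed.

Lemma closure_eball_sub (R : realType) (d : nat) (x y : 'rV[R]_d) (e : R) :
  0 < e -> closure (eball x e) y -> `|y - x| <= e.
Proof.
move=> e0 h.
have : closed_ball x e y.
  apply: closureS h => z; rewrite /eball /= => ze.
  rewrite -ball_normE /=; apply: le_lt_trans ze.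
  by rewrite distrC sup_norm_le_enorm.
by rewrite closed_ballE //= /closed_ball_ /= distrC.
Qed.

(** By the triangle inequality, radii up to a third of the distance suffice. *)
Lemma near_disjoint_eball (R : realType) (d : nat) (I : eqType)
    (x : I -> 'rV[R]_d) (i j : I) : injective x -> i != j ->
  \forall e \near @small_radii R I, forall y,
    closure (eball (x i) (e i)) y -> closure (eball (x j) (e j)) y -> False.
Proof.
move=> xI ij; exists (`|x i - x j| / 3).
  by rewrite divr_gt0 // normr_gt0 subr_eq0 (inj_eq xI).
move=> e he y.
have /andP[ei0 ei] := he i; have /andP[ej0 ej] := he j.
move=> /(closure_eball_sub ei0) yi /(closure_eball_sub ej0) yj.
have := ler_distD y (x i) (x j); rewrite (distrC (x i) y).
have : 0 < `|x i - x j| by rewrite normr_gt0 subr_eq0 (inj_eq xI).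
lra.
Qed.

Lemma eball_center (R : realType) (d : nat) (x : 'rV[R]_d) (e : R) :
  0 < e -> eball x e x.
Proof.
move=> e0; rewrite /eball /= /enorm subrr /dotrv big1 ?sqrtr0 // => k _.
by rewrite mxE mul0r.
Qed.

(** Whether a perturbation removes or adds its ball depends on the membership of
    its centre, which the other perturbation does not change because its closed
    ball avoids that centre. The two set operations then commute since one never
    touches a point affected by the other. *)
Lemma perturbC (R : realType) (d : nat) (W : set 'rV[R]_d) (x y : 'rV[R]_d)
    (e f : R) : 0 < e -> 0 < f ->
  (forall z, closure (eball x e) z -> closure (eball y f) z -> False) ->
  perturb (perturb W x e) y f = perturb (perturb W y f) x e.
Proof.
move=> e0 f0 dis.
have cx := subset_closure (eball_center x e0).
have cy := subset_closure (eball_center y f0).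
have keep u v r : 0 < r -> ~ closure (eball v r) u ->
    (u \in perturb W v r) = (u \in W).
  move=> r0 nu; apply/idP/idP; rewrite !inE /perturb; case: ifP => _ //.
  - by case.
  - by case=> // /subset_closure.
  - by left.
rewrite {1}/perturb keep //; last by move/dis; apply.
rewrite [RHS]/perturb keep //; last by move=> /(dis _ cx).
rewrite /perturb.
have Sx := @subset_closure _ (eball x e).
have Sy := @subset_closure _ (eball y f).
case: ifP => _; case: ifP => _; apply/seteqP; split=> z /=;
  move: (dis z) (Sx z) (Sy z); tauto.
Qed.

(** * Making the holes in reverse order *)

(** The perturbations indexed by [s], made from the last index to the first, so
    that the head of [s] is the most recent hole: inductions on [s] then add one
    hole to a set that is already perturbed. *)
Definition pierce (R : realType) (d : nat) (I : Type) (x : I -> 'rV[R]_d)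
    (e : I -> R) (W : set 'rV[R]_d) (s : seq I) : set 'rV[R]_d :=
  foldr (fun i S => perturb S (x i) (e i)) W s.

Lemma perturbs_pierce (R : realType) (d n : nat) (x : 'I_n -> 'rV[R]_d)
    (W : set 'rV[R]_d) : injective x ->
  \forall e \near @small_radii R 'I_n,
    perturbs W x e = pierce x e W (enum 'I_n).
Proof.
move=> xI.
have : \forall e \near @small_radii R 'I_n, forall i j, i != j ->
    forall z, closure (eball (x i) (e i)) z ->
              closure (eball (x j) (e j)) z -> False.
  apply: filter_forall => i.
  apply: filter_forall => j.
  have [->|ij] := eqVneq i j; first by apply: filterE.
  by apply: filterS (near_disjoint_eball xI ij) => e h _.
have pos : \forall e \near @small_radii R 'I_n, forall i, 0 < e i.
  by exists 1 => // e he i; have /andP[] := he i.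
apply: filterS2 pos => e pos dis.
(* Moving the first perturbation of a left fold to the outermost position. *)
rewrite /perturbs /pierce; elim: (enum 'I_n) (enum_uniq 'I_n) => //= i s ih.
move=> /andP[nis us]; rewrite -{}ih //.
elim: s W nis {us} => //= j s ih W.
rewrite inE negb_or => /andP[ij nis].
by rewrite -ih // perturbC //; apply: dis; rewrite // eq_sym.
Qed.

(** * Remainders along a perturbed set *)

Section Transfer.
Context (R : realType) (d : nat) (D W : set 'rV[R]_d) (I : eqType).
Context (x : I -> 'rV[R]_d) (base : seq 'rV[R]_d) (s : seq I).
Context (rmd : set 'rV[R]_d -> R -> R) (f : R -> R).
Context (xI : injective x) (xW : forall i, admissible D W (x i)).
Context (us : uniq s) (sb : forall i, i \in s -> x i \notin base).

(* The reversal undoes that of the right fold in [pierce]. *)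
Let y := fun k : 'I_(size (rev s)) => x (tnth (in_tuple (rev s)) k).

Let hole_y : hole_centres D W base y.
Proof.
split=> [k l /xI|k]; first by apply/tuple_uniqP; rewrite rev_uniq.
split; first exact: xW.
by apply: sb; rewrite -mem_rev (mem_tnth k (in_tuple _)).
Qed.

Let perturbs_y e :
  perturbs W y (fun k => e (tnth (in_tuple (rev s)) k)) = pierce x e W s.
Proof.
rewrite /perturbs /pierce -foldl_rev.
transitivity (foldl (fun S i => perturb S (x i) (e i)) W
  (map (tnth (in_tuple (rev s))) (enum 'I_(size (rev s))))); last first.
  by rewrite map_tnth_enum.
by elim: (enum _) W => //= k t ih V; exact: ih.
Qed.

(** The radius of the next hole is taken from the family [e] itself, at an
    arbitrary index [k]. *)
Lemma uniformly_o_pierce (c : R) (k : I) :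
  uniformly_o D W base rmd f -> 0 < c ->
  \forall e \near @small_radii R I,
    `|rmd (pierce x e W s) (e k)| <= c * f (e k).
Proof.
move=> hu c0; have [z z0 hz] := hu _ _ hole_y _ c0.
by exists z => // e he; rewrite -perturbs_y; apply: hz.
Qed.

Lemma uniformly_O_pierce : uniformly_O D W base rmd f ->
  exists2 C : R, 0 < C & forall k : I, \forall e \near @small_radii R I,
    `|rmd (pierce x e W s) (e k)| <= C * f (e k).
Proof.
move=> hu; have [z [C [z0 C0 hz]]] := hu _ _ hole_y.
exists C => // k.
by exists z => // e he; rewrite -perturbs_y; apply: hz.
Qed.

End Transfer.

(** * The expansion along successive holes *)

Section Coefficients.
Context (R : realType) (d : nat) (W : set 'rV[R]_d) (I : Type).
Context (x : I -> 'rV[R]_d) (J : set 'rV[R]_d -> R) (ell : R -> R).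
Context (D32 D2d : set 'rV[R]_d -> 'rV[R]_d -> R) (e : I -> R).

Local Notation b := (@ball_vol R d).

Definition one_hole (i : I) : R :=
  b (e i) * topD J W (x i) + ell (e i) * D32 W (x i)
  + b (e i) ^+ 2 / 2 * topD2 J D2d W (x i) (x i).

Definition two_holes (i j : I) : R :=
  b (e i) * b (e j) * topD2 J D2d W (x i) (x j).

End Coefficients.

Section Expansion.
Context (R : realType) (d : nat) (D W : set 'rV[R]_d) (I : eqType).
Context (x : I -> 'rV[R]_d) (J : set 'rV[R]_d -> R) (ell : R -> R).
Context (D32 D2d : set 'rV[R]_d -> 'rV[R]_d -> R).
Context (xI : injective x) (xW : forall i, admissible D W (x i)).

Local Notation b := (@ball_vol R d).
Local Notation one := (one_hole W x J ell D32 D2d).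
Local Notation two := (two_holes W x J D2d).

Context (b_gt0 : \forall r \near 0^'+, 0 < b r).
Context (ell_o : forall c : R, 0 < c -> \forall r \near 0^'+,
  `|ell r| <= c * b r).
Context (hA1 : forall x1, admissible D W x1 ->
  uniformly_o D W [:: x1] (remainder1 J ell D32 D2d x1) (fun r => b r ^+ 2)).
Context (hA2 : forall x1 x2, admissible D W x1 -> admissible D W x2 ->
  x1 <> x2 -> uniformly_o D W [:: x1; x2] (remainder2 J D2d x1 x2) b).
Context (hA3 : forall x1 x2, admissible D W x1 -> admissible D W x2 ->
  x1 <> x2 -> uniformly_O D W [:: x1; x2] (remainder3 D32 x1 x2) b).
Context (hA4 : forall x1 x2 x3, admissible D W x1 -> admissible D W x2 ->
  admissible D W x3 -> x1 <> x3 -> x2 <> x3 ->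
  uniformly_o D W [:: x1; x2; x3] (remainder4 J D2d x1 x2 x3) (fun=> 1)).

Lemma notin_base (i : I) (s t : seq I) :
  all (fun j => j \notin s) t -> i \in s -> x i \notin map x t.
Proof.
move=> /allP st si; rewrite (mem_map xI); apply/negP => ti.
by have := st _ ti; rewrite si.
Qed.

(** The differences made by the single holes add up; each of them is
    O(b_j), uniformly in the holes made before it. *)
Lemma D32_pierce (i : I) (s : seq I) :
  uniq s -> i \notin s ->
  exists2 C : R, 0 < C & \forall e \near @small_radii R I,
    `|D32 (pierce x e W s) (x i) - D32 W (x i)| <= C * \sum_(j <- s) b (e j).
Proof.
elim: s => [|j s ih] /=.
  move=> _ _; exists 1 => //; apply: filterE => e.
  by rewrite subrr normr0 big_nil mulr0.
rewrite inE negb_or => /andP[js us] /andP[ij nis].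
have [C C0 hC] := ih us nis.
have xij : x i <> x j by move/xI; apply/eqP.
have base : forall k, k \in s -> x k \notin [:: x i; x j].
  by move=> k; apply: (@notin_base k s [:: i; j]); rewrite /= nis js.
have [C' C'0 /(_ j) hC'] :=
  uniformly_O_pierce xI xW us base (hA3 (xW i) (xW j) xij).
exists (C + C'); first exact: addr_gt0.
near=> e.
have bp : forall k, 0 < b (e k).
  by near: e; exact: near_small_radii b_gt0.
have r1 : `|D32 (pierce x e W s) (x i) - D32 W (x i)|
    <= C * \sum_(j <- s) b (e j) by near: e.
have r2 : `|remainder3 D32 (x i) (x j) (pierce x e W s) (e j)| <= C' * b (e j).
  by near: e.
rewrite big_cons; set P := perturb _ _ _.
have S0 : 0 <= \sum_(j <- s) b (e j) by apply: sumr_ge0 => k _; apply/ltW.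
apply: le_trans (ler_distD (D32 (pierce x e W s) (x i)) _ _) _.
apply: le_trans (lerD r2 r1) _.
have := mulr_ge0 (ltW C'0) S0; have := mulr_gt0 C0 (bp j); lra.
Unshelve. all: by end_near. Qed.

(** A telescoping sum of o(1) terms. Indices [i] and [j] may coincide. *)
Lemma topD2_pierce (i j : I) (s : seq I) :
  uniq s -> i \notin s -> j \notin s -> forall c : R, 0 < c ->
  \forall e \near @small_radii R I,
    `|topD2 J D2d (pierce x e W s) (x i) (x j) -
      topD2 J D2d W (x i) (x j)| <= c.
Proof.
elim: s => [|k s ih] /=.
  move=> _ _ _ c c0; apply: filterE => e.
  by rewrite subrr normr0 ltW.
rewrite !inE !negb_or => /andP[ks us] /andP[ik nis] /andP[jk js] c c0.
have c20 : 0 < c / 2 by rewrite divr_gt0.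
have xik : x i <> x k by move/xI; apply/eqP.
have xjk : x j <> x k by move/xI; apply/eqP.
have base : forall l, l \in s -> x l \notin [:: x i; x j; x k].
  by move=> l; apply: (@notin_base l s [:: i; j; k]); rewrite /= nis js ks.
have := uniformly_o_pierce xI xW us base k
  (hA4 (xW i) (xW j) (xW k) xik xjk) c20.
apply: filterS2 (ih us nis js _ c20) => e r1 r2.
apply: le_trans (ler_distD (topD2 J D2d (pierce x e W s) (x i) (x j)) _ _) _.
by apply: le_trans (lerD r2 r1) _; lra.
Qed.

(** The hole at x_j contributes b_j D^2J(P)(x_i,x_j) with P the set perturbed by
    the earlier holes; [topD2_pierce] replaces P by W at the cost of an error
    o(b_j). *)
Lemma topD_pierce (i : I) (s : seq I) :
  uniq s -> i \notin s -> forall c : R, 0 < c ->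
  \forall e \near @small_radii R I,
    `|topD J (pierce x e W s) (x i) -
      (topD J W (x i) + \sum_(j <- s) b (e j) * topD2 J D2d W (x i) (x j))|
    <= c * \sum_(j <- s) b (e j).
Proof.
elim: s => [|j s ih] /=.
  move=> _ _ c c0; apply: filterE => e.
  by rewrite !big_nil addr0 subrr normr0 mulr0.
rewrite inE negb_or => /andP[js us] /andP[ij nis] c c0.
have c20 : 0 < c / 2 by rewrite divr_gt0.
have xij : x i <> x j by move/xI; apply/eqP.
have base : forall k, k \in s -> x k \notin [:: x i; x j].
  by move=> k; apply: (@notin_base k s [:: i; j]); rewrite /= nis js.
have hr := uniformly_o_pierce xI xW us base j
  (hA2 (xW i) (xW j) xij) c20.
have h4 := topD2_pierce us nis js c20.
near=> e.
have bp : forall k, 0 < b (e k).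
  by near: e; exact: near_small_radii b_gt0.
have r1 : `|topD J (pierce x e W s) (x i) -
    (topD J W (x i) + \sum_(j <- s) b (e j) * topD2 J D2d W (x i) (x j))|
    <= c * \sum_(j <- s) b (e j) by near: e; exact: ih.
have r2 : `|remainder2 J D2d (x i) (x j) (pierce x e W s) (e j)|
    <= c / 2 * b (e j).
  by near: e.
have r3 : `|topD2 J D2d (pierce x e W s) (x i) (x j) -
      topD2 J D2d W (x i) (x j)| <= c / 2.
  by near: e.
set P := pierce x e W s in r1 r2 r3 *.
rewrite !big_cons.
set E1 := (X in `|X| <= _) in r1; set E3 := (X in `|X| <= _) in r3.
(* S, T and U stand for the sum over s, the value at W and the value at the set
   with the hole at x_j added. *)
have -> : forall S T U, U - (T + (b (e j) * topD2 J D2d W (x i) (x j) + S)) =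
   (U - (topD J P (x i) + b (e j) * topD2 J D2d P (x i) (x j))) +
   (topD J P (x i) - (T + S)) + b (e j) * E3.
  by move=> S T U; rewrite /E3; ring.
rewrite [X in _ <= X]mulrDr addrAC.
apply: le_trans (ler_normD _ _) (lerD _ r1).
apply: le_trans (ler_normD _ _) _.
rewrite normrM (gtr0_norm (bp j)).
have := lerD r2 (ler_wpM2l (ltW (bp j)) r3).
rewrite /remainder2; lra.
Unshelve. all: by end_near. Qed.

(** The first index of [s] is the last hole made, and it precedes all the others
    in [prec]; hence its interactions with the earlier holes are the pair terms
    in which it comes first. *)
Lemma J_pierce (prec : rel I) (s : seq I) :
  (forall i j, prec i j -> ~~ prec j i) -> pairwise prec s ->
  forall c : R, 0 < c ->
  \forall e \near @small_radii R I,
    `|J (pierce x e W s) -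
      (J W + \sum_(i <- s) one e i
       + \sum_(i <- s) \sum_(j <- s | prec i j) two e i j)|
    <= c * \sum_(i <- s) b (e i) ^+ 2.
Proof.
move=> prec_asym.
have prec_irr i : prec i i = false.
  by apply/negP => ii; have := prec_asym _ _ ii; rewrite ii.
elim: s => [|i s ih] /=.
  move=> _ c c0; apply: filterE => e.
  by rewrite !big_nil !addr0 subrr normr0 mulr0.
move=> /andP[/allP prec_i prec_s] c c0.
have nis : i \notin s by apply/negP => /prec_i; rewrite prec_irr.
have us : uniq s by apply: pairwise_uniq prec_s.
(* The errors add up to c1 (2 b_i^2 + 2 b_i S), with S the sum of the b_j over
   s, and b_i S is at most K times the sum of all squares; c1 is what makes
   this at most c / 2 times that sum. *)
pose K : R := (size s).+1%:R.
have K0 : 0 < K by rewrite ltr0n.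
pose c1 := c / 2 / (2 + 2 * K).
have c10 : 0 < c1 by rewrite !divr_gt0 // addr_gt0 // mulr_gt0.
have c20 : 0 < c / 2 by rewrite divr_gt0.
have [C C0 h3] := D32_pierce us nis.
have h1 : \forall e \near @small_radii R I,
    `|remainder1 J ell D32 D2d (x i) (pierce x e W s) (e i)|
    <= c1 * b (e i) ^+ 2.
  apply: uniformly_o_pierce (hA1 (xW i)) c10 => // k.
  by apply: (@notin_base k s [:: i]); rewrite /= nis.
have h2 := topD_pierce us nis c10.
have h4 := topD2_pierce us nis nis c10.
(* l(e_i) = o(b_i) absorbs the constant C of the O-estimate. *)
have c1C : 0 < c1 / C by rewrite divr_gt0.
near=> e.
have bp : forall k, 0 < b (e k).
  by near: e; exact: near_small_radii b_gt0.
have le : forall k, `|ell (e k)| <= c1 / C * b (e k).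
  by near: e; exact: near_small_radii (ell_o c1C).
have r0 : `|J (pierce x e W s) -
    (J W + \sum_(i <- s) one e i
    + \sum_(i <- s) \sum_(j <- s | prec i j) two e i j)|
    <= c / 2 * \sum_(i <- s) b (e i) ^+ 2.
  by near: e; exact: ih.
have r1 : `|remainder1 J ell D32 D2d (x i) (pierce x e W s) (e i)|
    <= c1 * b (e i) ^+ 2.
  by near: e.
have r2 : `|topD J (pierce x e W s) (x i) -
    (topD J W (x i) + \sum_(j <- s) b (e j) * topD2 J D2d W (x i) (x j))|
    <= c1 * \sum_(j <- s) b (e j).
  by near: e.
have r3 : `|D32 (pierce x e W s) (x i) - D32 W (x i)|
    <= C * \sum_(j <- s) b (e j).
  by near: e.
have r4 : `|topD2 J D2d (pierce x e W s) (x i) (x i) -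
      topD2 J D2d W (x i) (x i)| <= c1.
  by near: e.
have pairs :
    \sum_(k <- i :: s) \sum_(j <- i :: s | prec k j) two e k j
    = b (e i) * (\sum_(j <- s) b (e j) * topD2 J D2d W (x i) (x j))
      + \sum_(k <- s) \sum_(j <- s | prec k j) two e k j.
  rewrite big_cons; congr (_ + _).
    rewrite big_cons prec_irr mulr_sumr big_seq_cond [RHS]big_seq_cond.
    rewrite [RHS](eq_bigl (fun j => (j \in s) && prec i j)).
      by apply: eq_bigr => j _; rewrite /two_holes mulrA.
    by move=> j; case: (boolP (j \in s)) => //= /prec_i.
  rewrite big_seq [RHS]big_seq; apply: eq_bigr => k ks.
  by rewrite big_cons (negbTE (prec_asym _ _ (prec_i _ ks))).
rewrite pairs !big_cons; set P := pierce x e W s in r0 r1 r2 r3 r4 *.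
rewrite /remainder1 in r1.
set Q := \sum_(i <- s) b (e i) ^+ 2 in r0 *.
set S := \sum_(j <- s) b (e j) in r2 r3.
set S1 := \sum_(i <- s) one e i in r0 *.
set S2 := \sum_(k <- s) \sum_(j <- s | _) _ in r0 *.
set S3 := \sum_(j <- s) _ * _ in r2 *.
set E0 := (X in `|X| <= _) in r0; set E1 := (X in `|X| <= _) in r1.
set E2 := (X in `|X| <= _) in r2; set E3 := (X in `|X| <= _) in r3.
set E4 := (X in `|X| <= _) in r4.
(* The total error, decomposed into that of the earlier holes, the one-hole
   remainder at P, and the three changes of coefficients from P to W. *)
have -> : J (perturb P (x i) (e i)) -
    (J W + (one e i + S1) + (b (e i) * S3 + S2)) =
    E0 + E1 + b (e i) * E2 + ell (e i) * E3 + b (e i) ^+ 2 / 2 * E4.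
  by rewrite /one_hole /E0 /E1 /E2 /E3 /E4; ring.
have Q0 : 0 <= Q by apply: sumr_ge0 => k _; exact: sqr_ge0.
have b20 : 0 <= b (e i) ^+ 2 by exact: sqr_ge0.
have S0 : 0 <= S by apply: sumr_ge0 => k _; apply/ltW.
have bS : b (e i) * S <= K * (b (e i) ^+ 2 + Q).
  have : b (e i) * S <= (size s)%:R * b (e i) ^+ 2 + Q.
    have -> : (size s)%:R * b (e i) ^+ 2 = \sum_(k <- s) b (e i) ^+ 2.
      by rewrite big_const_seq count_predT iter_addr_0 mulr_natl.
    rewrite mulr_sumr -big_split /=.
    apply: ler_sum => k _; have := sqr_ge0 (b (e i) - b (e k)).
    have := sqr_ge0 (b (e i)); have := sqr_ge0 (b (e k)); nra.
  move/le_trans; apply; rewrite /K -natr1 mulrDl mul1r mulrDr.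
  have : 0 <= (size s)%:R * Q by rewrite mulr_ge0.
  lra.
have t2 : `|b (e i) * E2| <= c1 * (b (e i) * S).
  rewrite normrM (gtr0_norm (bp i)) mulrCA.
  by rewrite ler_pM2l.
have t3 : `|ell (e i) * E3| <= c1 * (b (e i) * S).
  rewrite normrM.
  apply: le_trans (ler_pM (normr_ge0 _) (normr_ge0 _) (le i) r3) _.
  rewrite le_eqVlt; apply/orP; left; apply/eqP; field.
  by rewrite gt_eqF.
have t4 : `|b (e i) ^+ 2 / 2 * E4| <= c1 * b (e i) ^+ 2.
  rewrite normrM ger0_norm ?divr_ge0 //.
  apply: le_trans (ler_wpM2l _ r4) _; rewrite ?divr_ge0 //.
  have := mulr_ge0 (ltW c10) b20; lra.
have fin : c1 * (2 * b (e i) ^+ 2 + 2 * (b (e i) * S))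
    <= c / 2 * (b (e i) ^+ 2 + Q).
  have -> : c / 2 = c1 * (2 + 2 * K).
    by rewrite /c1 divfK // gt_eqF // addr_gt0 // mulr_gt0.
  rewrite -mulrA ler_pM2l //.
  have -> : (2 + 2 * K) * (b (e i) ^+ 2 + Q)
    = 2 * (b (e i) ^+ 2 + Q) + 2 * (K * (b (e i) ^+ 2 + Q)) by ring.
  lra.
do 4 (apply: le_trans (ler_normD _ _) _; rewrite -lerBrDr).
have := mulr_ge0 (ltW c20) b20; lra.
Unshelve. all: by end_near. Qed.

End Expansion.

(** * The theorem *)

Lemma quadratic_form_split (R : realType) (n : nat) (M : 'M[R]_n)
    (b : 'cV[R]_n) : M^T = M ->
  dotcv (M *m b) b = \sum_i b i 0 ^+ 2 * M i i
    + 2 * \sum_(i < n) \sum_(j < n | (i < j)%N) b i 0 * b j 0 * M i j.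
Proof.
move=> sM; pose F i j := b i 0 * b j 0 * M i j.
have FC i j : F i j = F j i.
  by rewrite /F -{1}sM mxE [b i 0 * _]mulrC.
have -> : dotcv (M *m b) b = \sum_i \sum_j F i j.
  rewrite /dotcv mxE; apply: eq_bigr => i _; rewrite !mxE mulr_suml.
  by apply: eq_bigr => j _; rewrite /F; ring.
have split_row i : \sum_j F i j =
    F i i + (\sum_(j < n | (i < j)%N) F i j + \sum_(j < n | (j < i)%N) F i j).
  rewrite (bigD1 i) //= (bigID (fun j : 'I_n => (i < j)%N)) /=.
  congr (_ + (_ + _)); apply: eq_bigl => j.
    by case: ltngtP => [||/val_inj->]; rewrite ?andbF ?andbT ?eqxx //; move=> h;
       apply/eqP => ji; move: h; rewrite ji ltnn.
  rewrite -leqNgt ltn_neqAle; congr (_ && _).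
rewrite (eq_bigr _ (fun i _ => split_row i)) !big_split /=.
congr (_ + _); rewrite mulr_natl mulr2n; congr (_ + _).
rewrite [LHS](exchange_big_dep xpredT) //=.
apply: eq_bigr => i _; apply: eq_bigr => j _; exact: FC.
Qed.

Theorem theorem2p10 (R : realType) (d : nat) (hd : d = 2%N \/ d = 3%N)
  (D : set 'rV[R]_d) (hD : bounded_C1_domain D)
  (A : set (set 'rV[R]_d))
  (hA : forall W : set 'rV[R]_d, open W -> W `<=` D -> A W)
  (JA : A -> R) (J : set 'rV[R]_d -> R) (hJ : J = extend0 JA)
  (delta : R) (hdelta : 0 < delta) (ell : R -> R)
  (hell_pos : forall e : R, 0 < e < delta -> 0 < ell e)
  (hell_bounds : \forall e \near 0^'+,
     ball_vol d e ^+ 2 < ell e < ball_vol d e)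
  (hell_o : ell e / ball_vol d e @[e --> 0^'+] --> 0)
  (D32 D2d : set 'rV[R]_d -> 'rV[R]_d -> R)
  (hDJ : forall (W : set 'rV[R]_d) (x1 : 'rV[R]_d),
     open W -> W `<=` D -> admissible D W x1 ->
     cvg (topD_quot J W x1 e @[e --> 0^'+]))
  (hD2J : forall (W : set 'rV[R]_d) (x1 x2 : 'rV[R]_d),
     open W -> W `<=` D -> admissible D W x1 -> admissible D W x2 ->
     x1 <> x2 -> cvg (topD2_quot J W x1 x2 e @[e --> 0^'+]))
  (hA1 : forall (W : set 'rV[R]_d) (x1 : 'rV[R]_d),
     open W -> W `<=` D -> admissible D W x1 ->
     uniformly_o D W [:: x1] (remainder1 J ell D32 D2d x1)
       (fun e => ball_vol d e ^+ 2))
  (hA2 : forall (W : set 'rV[R]_d) (x1 x2 : 'rV[R]_d),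
     open W -> W `<=` D -> admissible D W x1 -> admissible D W x2 ->
     x1 <> x2 ->
     uniformly_o D W [:: x1; x2] (remainder2 J D2d x1 x2)
       (fun e => ball_vol d e))
  (hA3 : forall (W : set 'rV[R]_d) (x1 x2 : 'rV[R]_d),
     open W -> W `<=` D -> admissible D W x1 -> admissible D W x2 ->
     x1 <> x2 ->
     uniformly_O D W [:: x1; x2] (remainder3 D32 x1 x2)
       (fun e => ball_vol d e))
  (hA4 : forall (W : set 'rV[R]_d) (x1 x2 x3 : 'rV[R]_d),
     open W -> W `<=` D ->
     admissible D W x1 -> admissible D W x2 -> admissible D W x3 ->
     x1 <> x3 -> x2 <> x3 ->
     uniformly_o D W [:: x1; x2; x3] (remainder4 J D2d x1 x2 x3)
       (fun=> 1)) :
  forall (W : set 'rV[R]_d) (n : nat) (x : 'I_n -> 'rV[R]_d),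
    open W -> W `<=` D -> (1 <= n)%N ->
    (forall i, admissible D W (x i)) ->
    (forall i j, i <> j -> x i <> x j) ->
    forall c : R, 0 < c -> exists2 zeta : R, 0 < zeta &
      forall e : 'I_n -> R, (forall i, 0 < e i <= zeta) ->
        let b : 'cV[R]_n := \col_i ball_vol d (e i) in
        let s : 'cV[R]_n := \col_i Num.sqrt (ell (e i)) in
        `| J (perturbs W x e) -
           (J W + dotcv (topDvec J W x) b
            + dotcv (topD32mx D32 W x *m s) s
            + 2^-1 * dotcv (topD2mx J D2d W x *m b) b) |
        <= c * \sum_(i < n) ball_vol d (e i) ^+ 2.
Proof.
move=> W n x oW WD _ xW xij c c0.
have xI : injective x.
  by move=> i j ij; apply/eqP/negPn/negP => /eqP /xij; apply.
(* Positivity of the volume of small balls is read off the bounds on ell. *)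
have b_gt0 : \forall r \near 0^'+, 0 < ball_vol d r :> R.
  apply: filterS hell_bounds => r /andP[bl lb].
  exact: le_lt_trans (sqr_ge0 _) (lt_trans bl lb).
have ell_ge0 : \forall r \near 0^'+, 0 <= ell r.
  apply: filterS hell_bounds => r /andP[bl _].
  by apply: le_trans (sqr_ge0 _) (ltW bl).
have ell_o c' : 0 < c' -> \forall r \near 0^'+, `|ell r| <= c' * ball_vol d r.
  move=> c'0; have /cvgrPdist_le/(_ _ c'0) := hell_o.
  apply: filterS2 b_gt0 => r b0.
  by rewrite sub0r normrN normrM normfV (gtr0_norm b0) ler_pdivrMr.
have lt_enum : pairwise (fun i j : 'I_n => i < j)%N (enum 'I_n).
  rewrite -(pairwise_map (@nat_of_ord n) ltn) val_enum_ord.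
  by rewrite -sorted_pairwise ?iota_ltn_sorted //; exact: ltn_trans.
have lt_asym (i j : 'I_n) : (i < j)%N -> ~~ (j < i)%N.
  by move=> ij; rewrite -leqNgt ltnW.
have hJe := J_pierce xI xW b_gt0 ell_o (fun y => hA1 W y oW WD)
  (fun y z => hA2 W y z oW WD) (fun y z => hA3 W y z oW WD)
  (fun y z t => hA4 W y z t oW WD) lt_asym lt_enum c0.
pose bv (e : 'I_n -> R) : 'cV[R]_n := \col_i ball_vol d (e i).
pose sv (e : 'I_n -> R) : 'cV[R]_n := \col_i Num.sqrt (ell (e i)).
suff : \forall e \near @small_radii R 'I_n,
    `| J (perturbs W x e) -
       (J W + dotcv (topDvec J W x) (bv e)
        + dotcv (topD32mx D32 W x *m sv e) (sv e)
        + 2^-1 * dotcv (topD2mx J D2d W x *m bv e) (bv e)) |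
    <= c * \sum_(i < n) ball_vol d (e i) ^+ 2 by [].
near=> e; set b := bv e; set s := sv e.
have ell_ge0_e : forall k, 0 <= ell (e k).
  by near: e; exact: near_small_radii ell_ge0.
have sum_enum (F : 'I_n -> R) : \sum_(i <- enum 'I_n) F i = \sum_(i < n) F i.
  by rewrite big_enum.
have pairs_enum (F : 'I_n -> 'I_n -> R) :
    \sum_(i <- enum 'I_n) \sum_(j <- enum 'I_n | (i < j)%N) F i j
    = \sum_(i < n) \sum_(j < n | (i < j)%N) F i j.
  by rewrite big_enum; apply: eq_bigr => i _; rewrite big_enum_cond.
have -> : perturbs W x e = pierce x e W (enum 'I_n).
  by near: e; apply: perturbs_pierce.
have : `|J (pierce x e W (enum 'I_n)) -
    (J W + \sum_(i <- enum 'I_n) one_hole W x J ell D32 D2d e i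
     + \sum_(i <- enum 'I_n) \sum_(j <- enum 'I_n | (i < j)%N)
         two_holes W x J D2d e i j)|
    <= c * \sum_(i <- enum 'I_n) ball_vol d (e i) ^+ 2.
  by near: e; exact: hJe.
rewrite pairs_enum !sum_enum.
have -> : dotcv (topDvec J W x) b = \sum_i ball_vol d (e i) * topD J W (x i).
  by rewrite /dotcv mxE; apply: eq_bigr => i _; rewrite !mxE mulrC.
have -> : dotcv (topD32mx D32 W x *m s) s = \sum_i ell (e i) * D32 W (x i).
  rewrite /dotcv mxE; apply: eq_bigr => i _.
  by rewrite /topD32mx mul_diag_mx !mxE -mulrA -expr2 sqr_sqrtr // mulrC.
have -> : 2^-1 * dotcv (topD2mx J D2d W x *m b) b =
    \sum_i ball_vol d (e i) ^+ 2 / 2 * topD2 J D2d W (x i) (x i)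
    + \sum_(i < n) \sum_(j < n | (i < j)%N)
        ball_vol d (e i) * ball_vol d (e j) * topD2 J D2d W (x i) (x j).
  rewrite quadratic_form_split; last first.
    apply/matrixP => i j; rewrite !mxE.
    by case: ltngtP => [_|_|/val_inj ->].
  rewrite mulrDr; congr (_ + _).
    rewrite mulr_sumr; apply: eq_bigr => i _; rewrite !mxE leqnn.
    by rewrite mulrA [2^-1 * _]mulrC.
  rewrite mulrA mulVf // mul1r.
  by apply: eq_bigr => i _; apply: eq_bigr => j ij; rewrite !mxE ltnW.
rewrite /one_hole !big_split /=.
by rewrite !addrA.
Unshelve. all: by end_near. Qed.
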